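(* There is no regular graph of degree $d\ge3$, diameter $3$ and cyclic defect.
   Context: For an integer $d\ge 1$ define polynomials $G_{d,m}(x)$ by $G_{d,0}(x)=1$, $G_{d,1}(x)=x+1$, and $G_{d,m+1}(x)=xG_{d,m}(x)-(d-1)G_{d,m-1}(x)$ for $m\ge1$. Let $J_n$ be the $n\times n$ all-ones matrix. For a graph on $n\ge3$ vertices, a cycle matrix is the adjacency matrix $B$ of an $n$-cycle on the same vertex set (i.e., for some ordering $v_1,\dots,v_n$ of the vertices, $B_{ij}=1$ iff $v_i,v_j$ are cyclically consecutive, and $0$ otherwise); this cycle need not consist of edges of the graph. A graph $\Gamma$ of order $n$ with adjacency matrix $A$ is a graph of degree $d$, diameter $D$ and cyclic defect if $\Gamma$ is $d$-regular with $d\ge3$, has diameter $D\ge2$, and $G_{d,D}(A)=J_n+B$ for some cycle matrix $B$. *)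

(* Defs.v *)
From mathcomp Require Import all_boot all_order all_algebra all_fingroup.

Set Implicit Arguments.
Unset Strict Implicit.
Unset Printing Implicit Defensive.

Import GRing.Theory.
Local Open Scope ring_scope.

Fixpoint G (d m : nat) {struct m} : {poly int} :=
  match m with
  | 0 => 1
  | 1 => 'X + 1
  | (m''.+1 as m').+1 => 'X * G d m' - (d%:R - 1) *: G d m''
  end.

Definition simple_graph (T : finType) (e : rel T) : Prop :=
  symmetric e /\ irreflexive e.

Definition regular (T : finType) (e : rel T) (d : nat) : Prop :=
  forall x : T, #|[set y | e x y]| = d.

Definition walk (T : finType) (e : rel T) (k : nat) (x y : T) : bool :=
  [exists p : k.-tuple T, path e x p && (last x p == y)].

(* Shortest walks have fewer than #|T| edges, so the search up to #|T| is
   exhaustive; dist e x y = #|T| exactly when y is unreachable from x. *)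
Definition dist (T : finType) (e : rel T) (x y : T) : nat :=
  find (fun k => walk e k x y) (iota 0 #|T|).

Definition has_diameter (T : finType) (e : rel T) (D : nat) : Prop :=
  (forall x y : T, connect e x y) /\
  (\max_(x : T) \max_(y : T) dist e x y)%N = D.

Definition adjacency (n : nat) (e : rel 'I_n) : 'M[int]_n :=
  \matrix_(i, j) (e i j)%:R.

(* v lists the vertices in cyclic order; ordS is the successor modulo n. *)
Definition cycle_matrix (n : nat) (B : 'M[int]_n) : Prop :=
  (3 <= n)%N /\
  exists v : 'S_n, forall i j : 'I_n,
    B (v i) (v j) = ((j == ordS i) || (i == ordS j))%:R.

(* The order is written n.+1 because horner_mx, the evaluation of a polynomial
   at a square matrix, requires a nonzero dimension. *)
Definition cyclic_defect_graph (n d D : nat) (e : rel 'I_n.+1) : Prop :=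
  [/\ simple_graph e,
      (3 <= d)%N /\ regular e d,
      (2 <= D)%N /\ has_diameter e D
    & exists2 B : 'M[int]_n.+1, cycle_matrix B &
        horner_mx (adjacency e) (G d D) = const_mx 1 + B].

(* Main.v *)
Require Import Defs.
From mathcomp Require Import all_boot all_order all_algebra all_fingroup.
From mathcomp Require Import zify ring.

(* Relabel the vertices by Z/N so that B is the standard cycle.  Applying
   G_{d,3}(A) = J + B to the all-ones vector gives N = (d - 1)(d^2 + 1), and A
   commutes with B since B = G_{d,3}(A) - J.

   If d is odd then 4 divides N, so ker B is the rank-2 lattice spanned by
   (1,0,-1,0,...) and its shift.  A acts on it by an integral 2x2 matrix
   annihilated by x^3 + x^2 - (d-1)(2x+1); such a matrix would force an integral
   root of this cubic, which is impossible because 2x + 1 would have to divide 1.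

   If d is even then N is odd, and commutation with the cycle together with the
   zero diagonal of A makes A circulant.  In such a Cayley graph of an abelian
   group there are at least 3d - 3 walks of length 3 between adjacent vertices,
   but G_{d,3}(A) = J + B allows at most 2d, whence d <= 3. *)

Set Implicit Arguments.
Unset Strict Implicit.
Unset Printing Implicit Defensive.
Import Order.TTheory GRing.Theory Num.Theory.
Local Open Scope ring_scope.

(** * Integral roots of the cubic, in [int] and in 2x2 matrices *)

Lemma mulz_eq1 (y z : int) : y * z = 1 -> y = 1 \/ y = -1.
Proof.
move/(congr1 absz); rewrite abszM => /eqP; rewrite muln_eq1 => /andP[/eqP y1 _].
lia.
Qed.

(** In terms of y = 2x + 1, eight times the cubic has constant term 1, so y divides 1; both x = 0
    and x = -1 then force [k = 0]. *)
Lemma cubic_no_root (k x : int) :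
  k != 0 -> x ^+ 3 + x ^+ 2 - 2 * k * x - k = 0 -> False.
Proof.
move=> k0 E.
have : (2 * x + 1) * (8 * k - (2 * x + 1) ^+ 2 + (2 * x + 1) + 1) = 1.
  have -> : (2 * x + 1) * (8 * k - (2 * x + 1) ^+ 2 + (2 * x + 1) + 1)
     = 1 - 8 * (x ^+ 3 + x ^+ 2 - 2 * k * x - k) by ring.
  by rewrite E; ring.
case/mulz_eq1 => y1; move: E.
  have -> : x = 0 by lia.
  rewrite !expr0n /=; lia.
have -> : x = -1 by lia.
rewrite -signr_odd -(signr_odd _ 2) /=; lia.
Qed.

(* [X * M = Y%:M] is what Cayley-Hamilton makes of
   [M ^+ 3 + M ^+ 2 - 2 * k * M - k = 0] for the 2x2 matrix M with entries
   [a], [b], [c], [e]. *)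
Lemma cubic_no_mx2_root (k a b c e : int) : k != 0 ->
  let t := a + e in let dl := a * e - b * c in
  let X := t ^+ 2 - dl + t - 2 * k in let Y := t * dl + dl + k in
  X * a = Y -> X * b = 0 -> X * c = 0 -> X * e = Y -> False.
Proof.
move=> k0 t dl X Y Ea Eb Ec Ee.
(* If [X = 0], the characteristic polynomial of [M] divides the cubic. The combination [X + 2 * Y]
   eliminates [k], and 2t + 1 turns out to divide 1. *)
have [X0|X0] := eqVneq X 0.
  have Y0 : Y = 0 by rewrite -Ea X0 mul0r.
  have E1 : t * (t + 1) = - dl * (2 * t + 1).
    have -> : t * (t + 1) = X + 2 * Y - dl * (2 * t + 1) by rewrite /X /Y; ring.
    by rewrite X0 Y0; ring.
  have : (2 * t + 1) * (2 * t + 1 + 4 * dl) = 1.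
    have -> : (2 * t + 1) * (2 * t + 1 + 4 * dl) =
      4 * (t * (t + 1)) + 1 + 4 * dl * (2 * t + 1) by ring.
    by rewrite E1; ring.
  case/mulz_eq1 => t1.
    have t0 : t = 0 by lia.
    have d0 : dl = 0 by move: E1; rewrite t0; lia.
    by move: Y0; rewrite /Y t0 d0; lia.
  have t0 : t = -1 by lia.
  have d0 : dl = 0 by move: E1; rewrite t0; lia.
  by move: Y0; rewrite /Y t0 d0; lia.
(* Otherwise [M] is scalar and [a] itself is a root. *)
have b0 : b = 0 by move/eqP: Eb; rewrite mulf_eq0 (negPf X0) => /eqP.
have c0 : c = 0 by move/eqP: Ec; rewrite mulf_eq0 (negPf X0) => /eqP.
have ea : e = a by apply: (mulfI X0); rewrite Ee Ea.
apply: (@cubic_no_root k a k0).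
have : X * a - Y = 0 by rewrite Ea subrr.
by rewrite /X /Y /t /dl b0 c0 ea => <-; ring.
Qed.

(** * Renumbering the vertices by Z/(n+3) *)

Lemma mxsub_mul (R : pzSemiRingType) n (v : 'S_n) (A B : 'M[R]_n) :
  mxsub v v (A *m B) = mxsub v v A *m mxsub v v B.
Proof.
apply/matrixP => i j; rewrite !mxE (reindex_inj (@perm_inj _ v)) /=.
by apply: eq_bigr => k _; rewrite !mxE.
Qed.

Lemma horner_mx_G3 n d (A : 'M[int]_n.+1) :
  horner_mx A (G d 3) =
  A *m A *m A + A *m A - (2 * (d%:R - 1)) *: A - (d%:R - 1) *: 1%:M.
Proof.
rewrite /=; move: (d%:R - 1 : int) => k.
have hZ (c : int) p : horner_mx A (c *: p) = c *: horner_mx A p by exact: linearZ.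
rewrite !(rmorphB, rmorphM, rmorphD, rmorph1) /= !hZ !(rmorphD, rmorph1) /=.
rewrite horner_mx_X -!mulmxE mulmxBr !mulmxDr mulmxA -idmxE -scalemxAr !mulmx1.
by rewrite scalerDr mulr_natl mulr2n scalerDl !opprD !addrA.
Qed.

(** Indices are added modulo [n.+3]; an order of at least 3 keeps [i + 1] and [i - 1] distinct. *)
Definition cyc n : 'M[int]_n.+3 :=
  \matrix_(i, j) ((j == i + 1) || (i == j + 1))%:R.

Definition defect_eq n (d : nat) (A : 'M[int]_n.+3) :=
  A *m A *m A + A *m A - (2 * (d%:R - 1)) *: A - (d%:R - 1) *: 1%:M =
  const_mx 1 + cyc n.

Lemma ordSE n (i : 'I_n.+3) : ordS i = i + 1.
Proof. by apply/val_inj; rewrite /= addn1. Qed.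

Lemma cyc_relabel n d (e : rel 'I_n.+3) (B : 'M[int]_n.+3) (v : 'S_n.+3) :
  (forall i j, B (v i) (v j) = ((j == ordS i) || (i == ordS j))%:R) ->
  horner_mx (adjacency e) (G d 3) = const_mx 1 + B ->
  defect_eq d (mxsub v v (adjacency e)).
Proof.
move=> HB HG; rewrite /defect_eq.
have -> : const_mx 1 + cyc n = mxsub v v (const_mx 1 + B).
  by apply/matrixP => i j; rewrite !mxE HB !ordSE.
rewrite -HG horner_mx_G3.
have sub1 : mxsub v v 1%:M = 1%:M :> 'M[int]_n.+3.
  by apply/matrixP => i j; rewrite !mxE (inj_eq perm_inj).
rewrite -{1}sub1 -!mxsub_mul.
by apply/matrixP => i j; rewrite !mxE.
Qed.

Lemma Zp_natP n (i : 'I_n.+3) : exists m, i = m%:R.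
Proof. by exists i; rewrite natr_Zp. Qed.

Lemma Zp_two_neq0 n : (1 + 1 : 'I_n.+3) != 0.
Proof. by []. Qed.

Lemma sum_cyc n (F : 'I_n.+3 -> int) i :
  \sum_k cyc n i k * F k = F (i + 1) + F (i - 1).
Proof.
have ne : i - 1 != i + 1.
  rewrite -subr_eq0; apply: contra (Zp_two_neq0 n) => /eqP E.
  by apply/eqP; rewrite -[LHS]opprK -[RHS]oppr0 -E; congr (- _); ring.
rewrite (bigD1 (i + 1)) //= (bigD1 (i - 1)) //= big1 => [|k /andP[k1 k2]].
  by rewrite !mxE eqxx subrK eqxx orbT !mul1r addr0.
by rewrite !mxE (negPf k1) /= -subr_eq eq_sym (negPf k2) mul0r.
Qed.

Lemma cyc_sym n i j : cyc n i j = cyc n j i.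
Proof. by rewrite !mxE orbC. Qed.

Lemma mul_cycl n p (M : 'M[int]_(n.+3, p)) i j :
  (cyc n *m M) i j = M (i + 1) j + M (i - 1) j.
Proof. by rewrite mxE (sum_cyc (fun k => M k j)). Qed.

Lemma mul_cycr n p (M : 'M[int]_(p, n.+3)) i j :
  (M *m cyc n) i j = M i (j + 1) + M i (j - 1).
Proof.
rewrite mxE -(sum_cyc (fun k => M i k)).
by apply: eq_bigr => k _; rewrite mulrC cyc_sym.
Qed.

(** * Commutation with the cycle and the order of the graph *)

Section Defect.
Variables (n d : nat) (A : 'M[int]_n.+3).
Hypothesis Asym : forall i j, A i j = A j i.
Hypothesis Areg : forall i, \sum_j A i j = d%:R.
Hypothesis Adef : defect_eq d A.

Local Notation J p := (const_mx 1 : 'M[int]_(n.+3, p)).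

Lemma mul_adj_const p : A *m J p = d%:R *: J p.
Proof.
apply/matrixP => i j; rewrite !mxE mulr1 -(Areg i).
by apply: eq_bigr => k _; rewrite !mxE mulr1.
Qed.

Lemma adj_cyc_comm : A *m cyc n = cyc n *m A.
Proof.
have AJ : A *m J n.+3 = J n.+3 *m A.
  rewrite mul_adj_const; apply/matrixP => i j; rewrite !mxE mulr1 -(Areg j).
  by apply: eq_bigr => k _; rewrite !mxE mul1r Asym.
have -> : cyc n = A *m A *m A + A *m A - (2 * (d%:R - 1)) *: A
    - (d%:R - 1) *: 1%:M - J n.+3 by rewrite Adef addrAC subrr add0r.
rewrite !(mulmxDr, mulmxDl, mulmxN, mulNmx) AJ -!scalemxAr -!scalemxAl.
by rewrite mulmx1 mul1mx !mulmxA.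
Qed.

Lemma defect_order : (n.+3 + 2)%:R = d%:R ^+ 3 - d%:R ^+ 2 + d%:R + 1 :> int.
Proof.
have := congr1 (fun M => (M *m J 1) 0 0) Adef.
rewrite !(mulmxDl, mulNmx) -!scalemxAl mul1mx -!mulmxA.
rewrite !(mul_adj_const, =^~scalemxAr) [in RHS]mxE mul_cycl.
rewrite [X in _ = X + _]mxE (eq_bigr (fun=> 1)) => [|k _]; last first.
  by rewrite !mxE mulr1.
rewrite sumr_const card_ord !mxE natrD => E.
have -> : n.+3%:R + 2 = n.+3%:R + (1 + 1) :> int by ring.
by rewrite -E; ring.
Qed.

(** Arranged without subtraction, which would truncate in [nat]. *)
Lemma defect_order_nat : (n.+3 + d ^ 2 + 1 = d ^ 3 + d)%N.
Proof.
apply/eqP; rewrite -(eqr_nat int); apply/eqP.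
have := defect_order; rewrite !natrD !natrX => E.
have -> : n.+3%:R = d%:R ^+ 3 - d%:R ^+ 2 + d%:R + 1 - 2 :> int by rewrite -E; ring.
ring.
Qed.

Lemma odd_degree_order : odd d -> (4 %| n.+3)%N.
Proof.
move=> dodd; have := defect_order_nat.
rewrite -[d]odd_double_half dodd -muln2.
set m := d./2 => E.
(* This is (d - 1)(d^2 + 1) at d = 2m + 1, where both factors are even. *)
have -> : n.+3 = (4 * (m * (2 * m ^ 2 + 2 * m + 1)))%N by nia.
exact: dvdn_mulr.
Qed.

Lemma even_degree_order : ~~ odd d -> odd n.+3.
Proof.
move=> dev; have /(congr1 odd) := defect_order_nat.
by rewrite !oddD !oddX /= (negPf dev) !addbF /= addbT => /negbFE.
Qed.

(** * Order divisible by 4: the action of [A] on the kernel of the cycle *)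

Section OrderDvd4.
Hypothesis N4 : (4 %| n.+3)%N.

(** The cosine of m quarter turns. *)
Definition phi (m : nat) : int := nth 0 [:: 1; 0; -1; 0] (m %% 4).

Lemma phiD2 m : phi m.+2 = - phi m.
Proof.
rewrite /phi -addn2 -modnDml; have := ltn_pmod m (isT : 0 < 4)%N.
by case: (m %% 4)%N => [|[|[|[|]]]].
Qed.

(** [wave 0] is a cosine and [wave 3] a sine: at the vertices 0 and 1 they take the values (1, 0)
    and (0, 1), so coordinates can be read off there. *)
Definition wave (s : nat) : 'cV[int]_n.+3 := \col_i phi (i + s).

(** The index [m%:R] is reduced modulo [n.+3], which does not affect [phi] because 4 divides
    [n.+3]. *)
Lemma waveE s m : wave s m%:R 0 = phi (m + s).
Proof.
by rewrite mxE /phi Zp_nat /= -(modnDml (_ %% _)) modn_dvdm // modnDml.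
Qed.

Lemma wave_combE a b s t m :
  (a *: wave s + b *: wave t) m%:R 0 = a * phi (m + s) + b * phi (m + t).
Proof. by rewrite -!waveE !mxE. Qed.

Lemma wave_shift s i : wave s (i + 1 + 1) 0 = - wave s i 0.
Proof.
have [m ->] := Zp_natP i.
by rewrite !natr1 !waveE !addSn phiD2.
Qed.

Lemma cyc_wave s : cyc n *m wave s = 0.
Proof.
apply/colP => i; rewrite mul_cycl [RHS]mxE.
by rewrite -{1}(subrK 1 i) wave_shift addNr.
Qed.

Lemma const_wave s : J n.+3 *m wave s = 0.
Proof.
apply/colP => i; rewrite [RHS]mxE mxE.
(* Translation by 2 permutes the vertices and negates the wave. *)
have E : \sum_k J n.+3 i k * wave s k 0 = - \sum_k J n.+3 i k * wave s k 0.
  rewrite {1}(reindex_inj (addIr (1 + 1 : 'I_n.+3))) /= -sumrN.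
  by apply: eq_bigr => k _; rewrite addrA wave_shift ![J _ _ _]mxE !mul1r.
by move: (\sum_k _) E => x; lia.
Qed.

(** Membership in the kernel is the recurrence w(j + 2) = -w(j), so the first two entries determine
    [w], with integral coefficients. *)
Lemma ker_cycP (w : 'cV[int]_n.+3) : cyc n *m w = 0 ->
  w = w 0 0 *: wave 0 + w 1 0 *: wave 3.
Proof.
move=> Ew; apply/colP => i; have [m ->] := Zp_natP i.
have step j : w (j + 1 + 1) 0 = - w j 0.
  have /colP/(_ (j + 1)) := Ew.
  by rewrite mul_cycl mxE addrK => /eqP; rewrite addr_eq0 => /eqP.
rewrite wave_combE.
suff : w m%:R 0 = w 0 0 * phi m + w 1 0 * phi (m + 3) /\
    w m.+1%:R 0 = w 0 0 * phi m.+1 + w 1 0 * phi (m.+1 + 3).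
  by case=> -> _; rewrite addn0.
elim: m => [|m [IH1 IH2]]; first by rewrite /phi /= !mulr1 !mulr0 addr0 add0r.
split=> //; rewrite -natr1 -natr1 step IH1 !addSn !phiD2; ring.
Qed.

Lemma adj_waveE s :
  exists a b, A *m wave s = a *: wave 0 + b *: wave 3.
Proof.
do 2!eexists; apply: ker_cycP.
by rewrite mulmxA -adj_cyc_comm -mulmxA cyc_wave mulmx0.
Qed.

Lemma wave_inj a b : a *: wave 0 + b *: wave 3 = 0 -> a = 0 /\ b = 0.
Proof.
move/colP=> E; have := E 0%:R; have := E 1%:R.
by rewrite !wave_combE !mxE /phi /= !mulr1 !mulr0 addr0 add0r.
Qed.

Lemma no_defect_mod4 : (1 < d)%N -> False.
Proof.
move=> d1; set k : int := d%:R - 1.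
have k0 : k != 0 by rewrite /k; lia.
have [a [b Ea]] := adj_waveE 0; have [c [e Ec]] := adj_waveE 3.
have key s : A *m (A *m (A *m wave s)) + A *m (A *m wave s)
     - (2 * k) *: (A *m wave s) - k *: wave s = 0.
  have := congr1 (fun M => M *m wave s) Adef.
  rewrite !(mulmxDl, mulNmx) -!scalemxAl mul1mx -!mulmxA => ->.
  by rewrite const_wave cyc_wave addr0.
have lin x y : A *m (x *: wave 0 + y *: wave 3) =
    (x * a + y * c) *: wave 0 + (x * b + y * e) *: wave 3.
  rewrite mulmxDr -!scalemxAr Ea Ec !scalerDr !scalerA !scalerDl.
  by rewrite addrACA.
have comb x y z t x' y' z' t' (p q : int) :
   x *: wave 0 + x' *: wave 3 + (y *: wave 0 + y' *: wave 3)
   - p *: (z *: wave 0 + z' *: wave 3) - q *: (t *: wave 0 + t' *: wave 3) =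
   (x + y - p * z - q * t) *: wave 0 + (x' + y' - p * z' - q * t') *: wave 3.
  by apply/colP => i; rewrite !mxE; ring.
have w0 : wave 0 = 1 *: wave 0 + 0 *: wave 3 by rewrite scale1r scale0r addr0.
have w3 : wave 3 = 0 *: wave 0 + 1 *: wave 3 by rewrite scale1r scale0r add0r.
have := key 0; rewrite [in X in _ - X]w0 Ea !lin comb => /wave_inj[E1 E2].
have := key 3; rewrite [in X in _ - X]w3 Ec !lin comb => /wave_inj[E3 E4].
(* [E1] to [E4] are the entries of the cubic at the matrix of [A] in the basis [wave 0], [wave 3];
   expanded, they are those of [X * M - Y%:M]. *)
apply: (@cubic_no_mx2_root k a b c e k0).
- by apply/eqP; rewrite -subr_eq0; apply/eqP; rewrite -[RHS]E1; ring.
- by rewrite -[RHS]E2; ring.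
- by rewrite -[RHS]E3; ring.
- by apply/eqP; rewrite -subr_eq0; apply/eqP; rewrite -[RHS]E4; ring.
Qed.

End OrderDvd4.

(** * Odd order: circulant matrices and counting walks *)

Section OddOrder.
Hypothesis Nodd : odd n.+3.
Hypothesis Adiag : forall i, A i i = 0.

(* Commutation with the cycle is a discrete wave equation: the increment of [A]
   along the diagonals depends on [i + j] only, and it vanishes at [i = j]. *)
Lemma adj_circ1 i j : A (i + 1) (j + 1) = A i j.
Proof.
pose D i j := A (i + 1) (j + 1) - A i j.
have D1 x y : D x y = D (x - 1) (y + 1).
  have /matrixP/(_ x (y + 1)) := adj_cyc_comm.
  rewrite mul_cycl mul_cycr /D addrK subrK => E.
  by apply/eqP; rewrite subr_eq addrAC eq_sym subr_eq E addrC.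
have Dm m x y : D x y = D (x - m%:R) (y + m%:R).
  elim: m x y => [|m IH] x y; first by rewrite subr0 addr0.
  by rewrite IH D1 -natr1 opprD !addrA.
apply/eqP; rewrite -subr_eq0; apply/eqP; rewrite -/(D i j).
(* (N + 1)/2 inverts 2 modulo the odd order N, so [k] is half of [i - j], and moving by [k] along
   the antidiagonal reaches the main diagonal. *)
pose k : 'I_n.+3 := (i - j) * (n.+3.+1./2)%:R.
have kk : k + k = i - j.
  rewrite /k -mulrDr -natrD addnn.
  have -> : ((n.+3.+1)./2.*2 = n.+3 + 1)%N by move: Nodd; lia.
  rewrite natrD (_ : n.+3%:R = 0) ?add0r ?mulr1 //.
  by apply/val_inj; rewrite Zp_nat /= modnn.
rewrite (Dm k) natr_Zp (_ : i - k = j + k); last first.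
  by apply/eqP; rewrite subr_eq -addrA kk addrC subrK.
by rewrite /D !Adiag subr0.
Qed.

Lemma adj_circ x i j : A (i + x) (j + x) = A i j.
Proof.
have [m ->] := Zp_natP x; elim: m => [|m IH]; first by rewrite !addr0.
by rewrite -natr1 !addrA adj_circ1.
Qed.

Lemma no_defect_odd : (forall i j, A i j = (A i j == 1)%:R) ->
  (3 < d)%N -> False.
Proof.
move=> A01 d3.
have A0 i j : 0 <= A i j by rewrite A01 ler0n.
have [s s1] : exists s, A 0 s = 1.
  case: (pickP (fun s => A 0 s == 1)) => [s /eqP ?|no]; first by exists s.
  have := Areg 0; rewrite big1 => [|j _]; last by rewrite A01 no.
  by move=> /eqP; rewrite eq_sym pnatr_eq0 => /eqP d0; rewrite d0 in d3.
have s0 : s != 0 by apply/eqP=> E; move: s1; rewrite E Adiag.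
have Aneg x : A 0 (- x) = A 0 x by rewrite -(adj_circ x) add0r addNr Asym.
have A2ss : (A *m A) s s = d%:R.
  rewrite mxE -(Areg s); apply: eq_bigr => j _.
  by rewrite (Asym j) A01; case: eqP => _; rewrite ?mulr0 ?mulr1.
have A2ge0 i j : 0 <= (A *m A) i j.
  by rewrite mxE sumr_ge0 // => k _; rewrite mulr_ge0.
(* Two walks from t to s pass through 0 and, by translation invariance, through t + s. They coincide
   when t = -s; when t = s there are d walks. *)
have A2 t : A 0 t = 1 -> (A *m A) t s >=
    2 - (t == - s)%:R + (d%:R - 2) * (t == s)%:R.
  move=> t1; have [->|ts] := eqVneq t s.
    by rewrite A2ss; case: (_ == _); lia.
  rewrite mulr0 addr0 mxE (bigD1 0) //= s1 Asym t1 mulr1.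
  have [ts'|ts'] := eqVneq t (- s).
    by rewrite (_ : 2 - _ = 1) // lerDl sumr_ge0 // => k _; rewrite mulr_ge0.
  rewrite (bigD1 (t + s)) /= ?addr_eq0 //.
  have -> : A t (t + s) = 1 by rewrite -[RHS]s1 -[RHS](adj_circ t) add0r addrC.
  have -> : A (t + s) s = 1 by rewrite Asym -[RHS]t1 -[RHS](adj_circ s) add0r.
  rewrite subr0 mulr1 addrA lerDl.
  by apply: sumr_ge0 => k _; rewrite mulr_ge0.
have A3 : (A *m A *m A) 0 s >= 3 * d%:R - 3.
  rewrite -mulmxA mxE.
  (* Over the d neighbours t of 0 the bounds add up to 2d - 1 + (d - 2). *)
  have -> : 3 * d%:R - 3 =
     \sum_t A 0 t * (2 - (t == - s)%:R + (d%:R - 2) * (t == s)%:R).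
    have -> : \sum_t A 0 t * (2 - (t == - s)%:R + (d%:R - 2) * (t == s)%:R) =
      \sum_t A 0 t * 2 - \sum_t A 0 t * (t == - s)%:R
        + \sum_t A 0 t * (t == s)%:R * (d%:R - 2).
      rewrite -sumrB -big_split; apply: eq_bigr => t _ /=; ring.
    have pt u : \sum_t A 0 t * (t == u)%:R = A 0 u.
      rewrite (bigD1 u) //= eqxx mulr1 big1 ?addr0 // => t /negPf ->.
      by rewrite mulr0.
    by rewrite -!mulr_suml Areg !pt Aneg s1; ring.
  apply: ler_sum => t _; rewrite A01; case: eqP => [/A2 le|_].
    by rewrite !mul1r.
  by rewrite !mul0r.
have ent (P Q : 'M[int]_n.+3) a b :
    P + Q - a *: A - b *: 1%:M = const_mx 1 + cyc n ->
    P 0 s + Q 0 s - a = 1 + cyc n 0 s.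
  move/matrixP/(_ 0 s); rewrite 7!mxE s1 !mxE (eq_sym 0) (negPf s0).
  by rewrite mulr1 mulr0 subr0.
have cyc1 : cyc n 0 s <= 1 by rewrite mxE; case: (_ || _).
(* The equation at (0, s) caps the walks of length 3 at 2(d - 1) + 2 = 2d. *)
have := ent _ _ _ _ Adef; move: (A2ge0 0 s) A3 cyc1 d3.
by move: ((_ *m _) 0 s) ((_ *m _) 0 s) (cyc n 0 s) => x y z; lia.
Qed.

End OddOrder.
End Defect.

Theorem theorem2 (n d : nat) (e : rel 'I_n.+1) :
  ~ cyclic_defect_graph d 3 e.
Proof.
case=> [[esym eirr] [d3 ereg] _ [B [N3 [v HB]] HG]].
case: n e esym eirr ereg B N3 v HB HG => [|[|n]] // e esym eirr ereg B _ v HB HG.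
pose A := mxsub v v (adjacency e).
have Adef : defect_eq d A by exact: cyc_relabel HG.
have Asym i j : A i j = A j i by rewrite !mxE esym.
have Areg i : \sum_j A i j = d%:R.
  rewrite -(ereg (v i)) -sum1_card natr_sum.
  rewrite [RHS](reindex_inj (@perm_inj _ v)) [RHS]big_mkcond /=.
  by apply: eq_bigr => j _; rewrite !mxE inE; case: (e _ _).
have [dodd|deven] := boolP (odd d).
  have N4 := odd_degree_order Areg Adef dodd.
  exact: (no_defect_mod4 Asym Areg Adef N4 (ltnW d3)).
have Nodd := even_degree_order Areg Adef deven.
apply: (no_defect_odd Asym Areg Adef Nodd).
- by move=> i; rewrite !mxE eirr.
- by move=> i j; rewrite !mxE; case: (e _ _).
- by rewrite ltn_neqAle d3 andbT; apply: contraNneq deven => <-.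
Qed.
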